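(* Let $(X,d)$ and $(Y,\rho)$ be pseudometric spaces. Then $(X,d)$ and $(Y,\rho)$ are pseudoisometric if and only if their metric identifications $(X/\!\sim_d,\delta_d)$ and $(Y/\!\sim_\rho,\delta_\rho)$ are isometric metric spaces.
   Context: A pseudometric on a set $X$ is a nonnegative symmetric function $d:X^2\to\mathbb R$ with $d(x,x)=0$ for all $x$ satisfying the triangle inequality. For a pseudometric space $(X,d)$, $x\sim_d y$ means $d(x,y)=0$; this is an equivalence relation, and $\delta_d(\alpha,\beta)=d(x,y)$ for $x\in\alpha$, $y\in\beta$ is a well-defined metric on the quotient $X/\!\sim_d$. The metric space $(X/\!\sim_d,\delta_d)$ is called the metric identification of $(X,d)$. A mapping $\Phi:X\to Y$ between pseudometric spaces $(X,d)$ and $(Y,\rho)$ is a pseudoisometry if (1) $\rho(\Phi(x),\Phi(y))=d(x,y)$ for all $x,y\in X$, and (2) for every $u\in Y$ there is $v\in X$ with $\rho(\Phi(v),u)=0$. $(X,d)$ and $(Y,\rho)$ are pseudoisometric if there exists a pseudoisometry $X\to Y$. Isometries of metric spaces are bijective distance preserving maps. *)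

(* Defs.v *)
From HB Require Import structures.
From mathcomp Require Import all_boot all_order all_algebra.
From mathcomp Require Import boolp reals.

Set Implicit Arguments.
Unset Strict Implicit.
Unset Printing Implicit Defensive.

Import Order.TTheory GRing.Theory Num.Theory.
Local Open Scope ring_scope.
Local Open Scope quotient_scope.

Record pseudometric (R : realType) (X : Type) := Pseudometric {
  pm_dist :> X -> X -> R;
  pm_ge0 : forall x y, 0 <= pm_dist x y;
  pm_refl : forall x, pm_dist x x = 0;
  pm_sym : forall x y, pm_dist x y = pm_dist y x;
  pm_triangle : forall x y z, pm_dist x z <= pm_dist x y + pm_dist y z }.

Record metric (R : realType) (X : Type) := Metric {
  metric_pm :> pseudometric R X;
  metric_eq0 : forall x y, metric_pm x y = 0 -> x = y }.

Definition pseudoisometry (R : realType) (X Y : Type)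
    (d : pseudometric R X) (rho : pseudometric R Y) (Phi : X -> Y) : Prop :=
  (forall x y, rho (Phi x) (Phi y) = d x y) /\
  (forall u, exists v, rho (Phi v) u = 0).

Definition pseudoisometric (R : realType) (X Y : Type)
    (d : pseudometric R X) (rho : pseudometric R Y) : Prop :=
  exists Phi : X -> Y, pseudoisometry d rho Phi.

Definition isometry (R : realType) (X Y : Type)
    (d : metric R X) (rho : metric R Y) (f : X -> Y) : Prop :=
  bijective f /\ (forall x y, rho (f x) (f y) = d x y).

Definition isometric (R : realType) (X Y : Type)
    (d : metric R X) (rho : metric R Y) : Prop :=
  exists f : X -> Y, isometry d rho f.

Section MetricIdentification.
Variables (R : realType) (X : Type) (d : pseudometric R X).

(* Generic quotients need a choiceType, whence the alias {classic X} of X. *)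
Definition dist0 : rel {classic X} := fun x y => d x y == 0.

Lemma dist0_refl : reflexive dist0.
Proof. by move=> x; rewrite /dist0 pm_refl. Qed.

Lemma dist0_sym : symmetric dist0.
Proof. by move=> x y; rewrite /dist0 pm_sym. Qed.

Lemma dist0_trans : transitive dist0.
Proof.
move=> y x z /eqP dxy /eqP dyz; rewrite /dist0 eq_le pm_ge0 andbT.
by have := pm_triangle d x y z; rewrite dxy dyz addr0.
Qed.

Canonical dist0_equiv := EquivRel dist0 dist0_refl dist0_sym dist0_trans.

Definition ident : Type := {eq_quot dist0_equiv}.

Definition ident_class (x : X) : ident := \pi_({eq_quot dist0_equiv}) x.

Definition ident_dist (a b : ident) : R :=
  d (repr (a : {eq_quot dist0_equiv})) (repr (b : {eq_quot dist0_equiv})).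

Lemma ident_classP x y : ident_class x = ident_class y <-> d x y = 0.
Proof. by split=> [/eqP|/eqP h]; [rewrite eqmodE => /eqP | apply/eqP; rewrite eqmodE]. Qed.

Lemma ident_class_repr (a : ident) :
  ident_class (repr (a : {eq_quot dist0_equiv})) = a.
Proof. exact: reprK. Qed.

Lemma pm_congr x x' y y' : d x x' = 0 -> d y y' = 0 -> d x y = d x' y'.
Proof.
have le u u' v v' : d u u' = 0 -> d v v' = 0 -> d u v <= d u' v'.
  move=> uu vv; apply: le_trans (pm_triangle d u u' v) _; rewrite uu add0r.
  by apply: le_trans (pm_triangle d u' v' v) _; rewrite [d v' v]pm_sym vv addr0.
by move=> xx yy; apply/eqP; rewrite eq_le !le // pm_sym.
Qed.

(* ident_dist does not depend on the representatives chosen by repr. *)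
Lemma ident_distE x y : ident_dist (ident_class x) (ident_class y) = d x y.
Proof. by apply: pm_congr; apply/ident_classP; rewrite ident_class_repr. Qed.

Definition ident_pseudometric : pseudometric R ident :=
  @Pseudometric R ident ident_dist (fun a b => pm_ge0 d _ _)
    (fun a => pm_refl d _) (fun a b => pm_sym d _ _)
    (fun a b c => pm_triangle d _ _ _).

Lemma ident_dist_eq0 (a b : ident) : ident_pseudometric a b = 0 -> a = b.
Proof.
by move=> h; rewrite -(ident_class_repr a) -(ident_class_repr b); apply/ident_classP.
Qed.

Definition metric_identification : metric R ident := Metric ident_dist_eq0.

End MetricIdentification.

(* Main.v *)
(** Distances in the metric identification are those of arbitrary
    representatives, so a pseudoisometry induces a map of classes that preserves
    distances and is onto, hence, between metric spaces, an isometry. Conversely,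
    composing an isometry of the quotients with the projection of [X] and a choice
    of representatives in [Y] gives a pseudoisometry. *)
Require Import Defs.
From mathcomp Require Import all_boot all_order all_algebra.
From mathcomp Require Import boolp reals.

Set Implicit Arguments.
Unset Strict Implicit.
Unset Printing Implicit Defensive.


Lemma ident_class_surj (R : realType) (X : Type) (d : pseudometric R X)
    (a : ident d) : exists x, ident_class d x = a.
Proof. by exists (repr (a : {eq_quot dist0_equiv d})%qT); exact: ident_class_repr. Qed.

(** A right inverse [g] of [f] is also a left inverse: [g (f x)] and [x] have the same image under
    [f], hence distance 0, and [d] separates points. *)
Lemma isometry_surj (R : realType) (X Y : Type) (d : metric R X)
    (rho : metric R Y) (f : X -> Y) :
  (forall x y, rho (f x) (f y) = d x y) -> (forall u, exists v, f v = u) ->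
  Defs.isometry d rho f.
Proof.
move=> fd /choice[g gK]; split=> //; exists g => // x.
by apply: (metric_eq0 (m := d)); rewrite -fd gK pm_refl.
Qed.

Theorem theorem2p18 (R : realType) (X Y : Type)
    (d : pseudometric R X) (rho : pseudometric R Y) :
  pseudoisometric d rho <->
  isometric (metric_identification d) (metric_identification rho).
Proof.
have [r rK] := choice (@ident_class_surj R X d).
have [s sK] := choice (@ident_class_surj R Y rho).
split=> [[Phi [Phid Phis]]|[f [[g fK gK] fd]]].
  exists (fun a => ident_class rho (Phi (r a))); apply: isometry_surj => [a b|u].
    by rewrite /= ident_distE Phid -(ident_distE d) !rK.
  have [v vu] := Phis (s u); exists (ident_class d v).
  rewrite -[RHS]sK; apply/ident_classP; rewrite -vu.
  (* [r] may pick a representative other than [v], but one at distance 0 from [v], so [Phi] sends it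
     to distance 0 from [Phi v]. *)
  by apply: pm_congr; rewrite ?pm_refl // Phid; apply/ident_classP; rewrite rK.
exists (fun x => s (f (ident_class d x))); split=> [x y|u].
  by rewrite -(ident_distE rho) !sK -(ident_distE d); exact: fd.
(* [v] represents the preimage under [f] of the class of [u]. *)
have [v vE] := ident_class_surj (g (ident_class rho u)).
by exists v; apply/ident_classP; rewrite sK vE gK.
Qed.
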